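(* Let $G$ be a connected simple graph with $n$ vertices $v_1,\ldots,v_n$ and with a vertex weight $\omega$. Then $$LE_\omega(G)\leq n\,\mathrm{MD}_\omega(G)+E(G).$$ Moreover, equality holds if and only if $G$ is $\omega$-regular.
   Context: Graphs are finite, simple, with nonempty vertex set $V(G)=\{v_1,\ldots,v_n\}$. A vertex weight $\omega$ of $G$ is a function from $V(G)$ to the set of positive real numbers. $G$ is called $\omega$-regular if $\omega(u)=\omega(v)$ for all $u,v\in V(G)$. Write $\overline{\omega}=\frac1n\sum_{i=1}^n\omega(v_i)$. $A(G)$ denotes the $(0,1)$ adjacency matrix of $G$, and $D_\omega(G)=\mathrm{diag}(\omega(v_1),\ldots,\omega(v_n))$. The weighted Laplacian matrix is $L_\omega(G)=D_\omega(G)-A(G)$. The energy of $G$ is $E(G)=\sum_{i=1}^n|\lambda_i|$, where $\lambda_1,\ldots,\lambda_n$ are the eigenvalues of $A(G)$ (with multiplicity). The weighted Laplacian energy is $LE_\omega(G)=\sum_{i=1}^n|\mu_i-\overline{\omega}|$, where $\mu_1,\ldots,\mu_n$ are the eigenvalues of $L_\omega(G)$ (with multiplicity). The mean deviation of $G$ with respect to $\omega$ is $\mathrm{MD}_\omega(G)=\frac1n\sum_{i=1}^n|\omega(v_i)-\overline{\omega}|$. *)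

(* Defs.v *)
From mathcomp Require Import all_boot all_order all_algebra.
From mathcomp Require Import reals polyrcf complex.

Set Implicit Arguments.
Unset Strict Implicit.
Unset Printing Implicit Defensive.

Import Order.TTheory GRing.Theory Num.Theory.
Local Open Scope ring_scope.

Record sgraph := SGraph {
  vertex :> finType;
  edge : rel vertex;
  edge_sym : symmetric edge;
  edge_irrefl : irreflexive edge;
  vertex_gt0 : (0 < #|vertex|)%N }.

Definition graph_connected (G : sgraph) : Prop :=
  forall u v : G, connect (@edge G) u v.

(* The vertices v_1, ..., v_n are [enum_val i] for [i : 'I_#|G|]. *)
Definition adjmx (R : realType) (G : sgraph) : 'M[R]_#|G| :=
  \matrix_(i, j) (edge (enum_val i) (enum_val j))%:R.

Definition weight_mx (R : realType) (G : sgraph) (w : G -> R) : 'M[R]_#|G| :=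
  diag_mx (\row_i w (enum_val i)).

Definition weighted_laplacian (R : realType) (G : sgraph) (w : G -> R)
    : 'M[R]_#|G| :=
  weight_mx w - adjmx R G.

(* The real eigenvalues of A, each repeated according to its multiplicity as a
   root of the characteristic polynomial.  [rootsR] lists the distinct roots;
   for a symmetric matrix these are all the eigenvalues: see
   [char_poly_eigenvalues]. *)
Definition eigenvalues (R : realType) (n : nat) (A : 'M[R]_n) : seq R :=
  flatten [seq nseq (mup a (char_poly A)) a | a <- rootsR (char_poly A)].

Definition mean_weight (R : realType) (G : sgraph) (w : G -> R) : R :=
  (#|G|%:R)^-1 * \sum_(v : G) w v.

Definition energy (R : realType) (G : sgraph) : R :=
  \sum_(a <- eigenvalues (adjmx R G)) `|a|.

Definition weighted_laplacian_energy (R : realType) (G : sgraph) (w : G -> R)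
    : R :=
  \sum_(a <- eigenvalues (weighted_laplacian w)) `|a - mean_weight w|.

Definition mean_deviation (R : realType) (G : sgraph) (w : G -> R) : R :=
  (#|G|%:R)^-1 * \sum_(v : G) `|w v - mean_weight w|.

Definition weight_regular (R : realType) (G : sgraph) (w : G -> R) : Prop :=
  forall u v : G, w u = w v.

Lemma eigenvalues_perm (R : realType) (n : nat) (A : 'M[R]_n) (s : seq R) :
  char_poly A = \prod_(a <- s) ('X - a%:P) -> perm_eq (eigenvalues A) s.
Proof.
move=> pE; have p0 : char_poly A != 0 by rewrite monic_neq0 ?char_poly_monic.
have mupE a : mup a (char_poly A) = count_mem a s by rewrite pE mu_prod_XsubC.
have rP a : (a \in rootsR (char_poly A)) = (a \in s).
  by rewrite -(roots_on_rootsR p0) inE /= pE root_prod_XsubC.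
have ur : uniq (rootsR (char_poly A)) by exact: uniq_roots.
apply/allP => x _ /=; apply/eqP.
rewrite /eigenvalues count_flatten -map_comp sumnE big_map.
rewrite (eq_bigr (fun a => if a == x then count_mem x s else 0%N)); last first.
  move=> a _; rewrite /= count_nseq /= mupE.
  by case: eqP => [->|]; rewrite ?mul1n ?mul0n.
rewrite -big_mkcond /=; have [xs|xs] := boolP (x \in s).
  by rewrite -big_filter filter_pred1_uniq ?rP // big_seq1.
by rewrite (count_memPn xs) big1.
Qed.

Lemma char_poly_eigenvalues (R : realType) (n : nat) (A : 'M[R]_n) :
  A^T = A -> char_poly A = \prod_(a <- eigenvalues A) ('X - a%:P).
Proof.
move=> Asym; pose f := real_complex R; pose B := map_mx f A.
have Bherm : B \is hermsymmx.
  apply: realsym_hermsym.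
    apply/is_hermitianmxP; rewrite expr0 scale1r.
    by apply/matrixP => i j; rewrite !mxE -[in LHS]Asym mxE.
  apply/mxOverP => i j; rewrite mxE /f.
  by rewrite complex_real.
have /hermitian_spectral_diag_real /mxOverP dreal := Bherm.
have /orthomx_spectralP Bdiag := hermitian_normalmx Bherm.
pose d := spectral_diag B; pose P := spectralmx B.
have Pu : P \in unitmx by exact: spectral_unit.
have cB : char_poly B = \prod_(i < n) ('X - (d 0 i)%:P).
  have DP : P *m B = diag_mx d *m P by rewrite [in LHS]Bdiag !mulmxA mulmxV ?mul1mx.
  have cP : map_mx polyC P *m char_poly_mx B =
            char_poly_mx (diag_mx d) *m map_mx polyC P.
    by rewrite /char_poly_mx mulmxBr mulmxBl -!map_mxM /= DP scalar_mxC.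
  have := congr1 determinant cP; rewrite !det_mulmx mulrC => /mulIf cE.
  rewrite /char_poly cE ?det_map_mx ?polyC_eq0 -?unitfE -?unitmxE //.
  rewrite -/(char_poly _) char_poly_trig ?diag_mx_is_trig //.
  by apply: eq_bigr => i _; rewrite mxE eqxx.
pose s := [seq complex.Re (d 0 i) | i <- enum 'I_n].
have cA : char_poly A = \prod_(a <- s) ('X - a%:P).
  apply: (map_poly_inj f); rewrite map_char_poly -/B cB.
  rewrite rmorph_prod big_map big_enum /=; apply: eq_bigr => i _.
  rewrite rmorphB /= map_polyX map_polyC /=; congr ('X - _%:P).
  by rewrite [RHS]RRe_real.
by rewrite cA (perm_big _ (eigenvalues_perm cA)).
Qed.

Lemma adjmx_sym (R : realType) (G : sgraph) : (adjmx R G)^T = adjmx R G.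
Proof. by apply/matrixP => i j; rewrite !mxE edge_sym. Qed.

Lemma weighted_laplacian_sym (R : realType) (G : sgraph) (w : G -> R) :
  (weighted_laplacian w)^T = weighted_laplacian w.
Proof.
by rewrite /weighted_laplacian linearB /= adjmx_sym /weight_mx tr_diag_mx.
Qed.

(* Main.v *)
Require Import Defs.
From mathcomp Require Import all_boot all_order all_algebra.
From mathcomp Require Import reals.
From mathcomp Require Import complex.

Import Order.TTheory GRing.Theory Num.Theory.
Local Open Scope ring_scope.
Local Open Scope sesquilinear_scope.

(** The trace norm of a Hermitian matrix T is the sum of the absolute values of
    its eigenvalues, so E(G) is the trace norm of B = - A(G), and LE_w(G) is the
    trace norm of L_w(G) - m I = X + B, where m is the mean weight and X is the
    diagonal matrix with entries w(v_i) - m.  The trace norm of X is n MD_w(G),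
    and the inequality is the triangle inequality.

    Every Hermitian T has a polar decomposition T = J |T| whose sign J is a
    Hermitian involution commuting with |T| ([diag_conj_polar]).  For every
    Hermitian involution S, the defect \tr |T| - \tr (S T) is half the squared
    Frobenius norm of |T|^(1/2) (S - J) ([polar_trace_defect]).  Hence
    \tr (S T) <= \tr |T|, and equality forces S T = T S = |T|.  Taking for S
    the sign of X + B and adding the inequalities for X and for B gives the
    triangle inequality.

    If equality holds ([polar_diagD]), then X S = |X|, so for x_i <> 0 the i-th
    row of S is a multiple of the i-th basis vector; since B has zero diagonal,
    the (i, i) entry of |B| = S B vanishes.  As |B| is positive semidefinite,
    its i-th row vanishes, hence so does that of B, and v_i is isolated.
    In a connected graph this leaves two cases: either all x_i are 0, or there
    is a single vertex; the weight is constant in both.  Conversely, if the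
    weight is constant then X = 0 and both sides are the trace norm of B.

    Matrices over a real field R are mapped to R[i], where Hermitian matrices
    are unitarily diagonalizable. *)

(** * Signed square roots and the trace norm *)

Lemma trCmx_mul {C : numClosedFieldType} m n p (A : 'M[C]_(m, n))
    (B : 'M[C]_(n, p)) : (A *m B)^t* = B^t* *m A^t*.
Proof. by rewrite trmx_mul map_mxM. Qed.

Lemma trCmxB {C : numClosedFieldType} m n (A B : 'M[C]_(m, n)) :
  (A - B)^t* = A^t* - B^t*.
Proof. by rewrite linearB /= map_mxB. Qed.

Lemma mulmx_trC_diag {C : numClosedFieldType} m n (A : 'M[C]_(m, n)) i :
  (A *m A^t*) i i = \sum_j `|A i j| ^+ 2.
Proof. by rewrite mxE; apply: eq_bigr => j _; rewrite !mxE normCK. Qed.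

Lemma mulmx_trC_diag_eq0 {C : numClosedFieldType} m n (A : 'M[C]_(m, n)) i :
  (A *m A^t*) i i = 0 -> row i A = 0.
Proof.
rewrite mulmx_trC_diag => /eqP; rewrite psumr_eq0 => [/allP h|j _]; last first.
  exact: exprn_ge0.
apply/rowP => j; rewrite !mxE; apply/eqP; rewrite -normr_eq0.
by have := h j (mem_index_enum j); rewrite /= expf_eq0.
Qed.

Lemma mxtrace_mulmx_trC_ge0 {C : numClosedFieldType} m n (A : 'M[C]_(m, n)) :
  0 <= \tr (A *m A^t*).
Proof.
apply: sumr_ge0 => i _; rewrite mulmx_trC_diag.
by apply: sumr_ge0 => j _; exact: exprn_ge0.
Qed.

Lemma mxtrace_mulmx_trC_eq0 {C : numClosedFieldType} m n (A : 'M[C]_(m, n)) :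
  \tr (A *m A^t*) = 0 -> A = 0.
Proof.
move/eqP; rewrite psumr_eq0 => [/allP h|i _]; last first.
  by rewrite mulmx_trC_diag; apply: sumr_ge0 => j _; exact: exprn_ge0.
apply/row_matrixP => i; rewrite row0; apply: mulmx_trC_diag_eq0.
by apply/eqP; exact: (h i (mem_index_enum i)).
Qed.

(** Equivalently, a Hermitian unitary matrix: a possible sign of a Hermitian
    matrix. *)
Definition hermitian_involution {C : numClosedFieldType} {n : nat}
  (S : 'M[C]_n) : Prop := S^t* = S /\ S *m S = 1%:M.

(** A polar decomposition T = J |T| of a Hermitian matrix T in which the
    absolute value |T| = W ^ 2 is given through a Hermitian square root W.
    The sign J is required to be an involution even on the kernel of T, where T
    does not determine it.  The trace norm of T is \tr (W *m W). *)
Definition polar {C : numClosedFieldType} {n : nat} (T J W : 'M[C]_n) : Prop :=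
  [/\ hermitian_involution J, W^t* = W, J *m W = W *m J & T = J *m W *m W].

(** Twice the defect in the duality inequality \tr (S T) <= \tr |T| is a squared
    Frobenius norm. *)
Lemma polar_trace_defect {C : numClosedFieldType} {n} (T J W S : 'M[C]_n) :
    polar T J W -> hermitian_involution S ->
  \tr ((W *m (S - J)) *m (W *m (S - J))^t*) =
  (\tr (W *m W) - \tr (S *m T)) *+ 2.
Proof.
move=> [[Jh JJ] Wh JW TE] [Sh SS].
rewrite trCmx_mul Wh trCmxB Jh Sh mulmxA -(mulmxA W).
have -> : (S - J) *m (S - J) = 1%:M + 1%:M - (S *m J + J *m S).
  by rewrite mulmxBl !mulmxBr SS JJ opprB addrACA opprD.
have WWJ : W *m W *m J = J *m W *m W by rewrite -mulmxA -JW mulmxA -JW.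
have SJ : \tr (W *m (S *m J) *m W) = \tr (S *m T).
  by rewrite TE -mulmxA mxtrace_mulC !mulmxA.
have JS : \tr (W *m (J *m S) *m W) = \tr (S *m T).
  rewrite TE !mulmxA -(mulmxA (W *m J)) mxtrace_mulC mulmxA.
  by rewrite -!(mulmxA S) WWJ.
rewrite mulmxBr mulmxBl !mulmxDr !mulmxDl mulmx1 raddfB !raddfD /= SJ JS.
by rewrite mulr2n addrACA.
Qed.

Lemma polar_trace_le {C : numClosedFieldType} {n} (T J W S : 'M[C]_n) :
    polar T J W -> hermitian_involution S ->
  \tr (S *m T) <= \tr (W *m W).
Proof.
move=> pT hS; rewrite -subr_ge0 -(pmulrn_lge0 _ (ltn0Sn 1)).
by rewrite -(polar_trace_defect _ _ _ _ pT hS) mxtrace_mulmx_trC_ge0.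
Qed.

(** In the equality case S acts as a sign of T on both sides. *)
Lemma polar_trace_eq {C : numClosedFieldType} {n} (T J W S : 'M[C]_n) :
    polar T J W -> hermitian_involution S ->
    \tr (S *m T) = \tr (W *m W) ->
  T *m S = W *m W /\ S *m T = W *m W.
Proof.
move=> pT hS E; have := polar_trace_defect _ _ _ _ pT hS.
rewrite E subrr mul0rn => /mxtrace_mulmx_trC_eq0.
case: pT hS => [[Jh JJ] Wh JW TE] [Sh SS].
rewrite mulmxBr => /eqP; rewrite subr_eq0 => /eqP WS.
have SW : S *m W = J *m W by rewrite -Sh -Jh -Wh -!trCmx_mul WS.
split.
  by rewrite TE -mulmxA WS -JW mulmxA -(mulmxA J) -JW mulmxA JJ mul1mx.
by rewrite TE JW -(mulmxA W) JW !mulmxA SW -!mulmxA -JW !mulmxA JW -(mulmxA W J)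
  JJ mulmx1.
Qed.

(** The trace norm does not depend on the polar decomposition. *)
Lemma polar_trace_uniq {C : numClosedFieldType} {n} (T J W J' W' : 'M[C]_n) :
  polar T J W -> polar T J' W' -> \tr (W *m W) = \tr (W' *m W').
Proof.
have self J1 W1 : polar T J1 W1 -> \tr (J1 *m T) = \tr (W1 *m W1).
  by case=> [[_ JJ] _ _ ->]; rewrite -mulmxA mulmxA JJ mul1mx.
have le J1 W1 J2 W2 : polar T J1 W1 -> polar T J2 W2 ->
    \tr (W1 *m W1) <= \tr (W2 *m W2).
  move=> p1 p2; rewrite -(self _ _ p1); apply: (polar_trace_le _ _ _ _ p2).
  by case: p1.
by move=> p p'; apply/eqP; rewrite eq_le (le _ _ _ _ p p') (le _ _ _ _ p' p).
Qed.

(** * Polar decomposition of a diagonalized matrix *)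

(** The matrix P^* diag(d) P; for P unitary, its eigenvalues are the d_i.  The
    diagonal is a plain function on indices, so that applying a real function to
    the eigenvalues is a pointwise operation. *)
Definition diag_conj {C : numClosedFieldType} {n : nat} (P : 'M[C]_n)
  (d : 'I_n -> C) : 'M[C]_n := P^t* *m diag_mx (\row_i d i) *m P.

Lemma diag_conj1 {C : numClosedFieldType} {n} (d : 'I_n -> C) :
  diag_conj 1%:M d = diag_mx (\row_i d i).
Proof. by rewrite /diag_conj trmx1 map_mx1 mul1mx mulmx1. Qed.

Lemma diag_conjM {C : numClosedFieldType} {n} (P : 'M[C]_n) (d e : 'I_n -> C) :
  P \is unitarymx ->
  diag_conj P d *m diag_conj P e = diag_conj P (fun i => d i * e i).
Proof.
move=> /unitarymxP PP; rewrite /diag_conj !mulmxA -(mulmxA _ P) PP mulmx1.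
rewrite -(mulmxA (P^t*) (diag_mx _)) mulmx_diag; congr (_ *m diag_mx _ *m _).
by apply/rowP => i; rewrite !mxE.
Qed.

Lemma diag_conj_herm {C : numClosedFieldType} {n} (P : 'M[C]_n)
    (d : 'I_n -> C) :
  (forall i, d i \is Num.real) -> (diag_conj P d)^t* = diag_conj P d.
Proof.
move=> dr; rewrite /diag_conj !trCmx_mul trmxCK mulmxA tr_diag_mx map_diag_mx.
congr (_ *m diag_mx _ *m _).
by apply/rowP => i; rewrite !mxE; apply/CrealP.
Qed.

Lemma diag_conj_tr {C : numClosedFieldType} {n} (P : 'M[C]_n) (d : 'I_n -> C) :
  P \is unitarymx -> \tr (diag_conj P d) = \sum_i d i.
Proof.
move=> /unitarymxP PP; rewrite /diag_conj mxtrace_mulC mulmxA PP mul1mx.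
by rewrite mxtrace_diag; apply: eq_bigr => i _; rewrite mxE.
Qed.

Lemma diag_conj_char_poly {C : numClosedFieldType} {n} (P : 'M[C]_n)
    (d : 'I_n -> C) : P \is unitarymx ->
  char_poly (diag_conj P d) = \prod_i ('X - (d i)%:P).
Proof.
move=> Pu; set B := diag_conj P d; pose D := diag_mx (\row_i d i).
have DP : P *m B = D *m P.
  by have /unitarymxP PP := Pu; rewrite /B /diag_conj !mulmxA PP mul1mx.
have cP : map_mx polyC P *m char_poly_mx B = char_poly_mx D *m map_mx polyC P.
  by rewrite /char_poly_mx mulmxBr mulmxBl -!map_mxM /= DP scalar_mxC.
have := congr1 determinant cP; rewrite !det_mulmx mulrC => /mulIf cE.
rewrite /char_poly cE ?det_map_mx ?polyC_eq0 -?unitfE -?unitmxE //.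
  rewrite -/(char_poly D) char_poly_trig ?diag_mx_is_trig //.
  by apply: eq_bigr => i _; rewrite !mxE eqxx mulr1n.
exact: unitarymx_unit.
Qed.

(** The sign and the square root of the absolute value are taken pointwise on
    the eigenvalues. *)
Lemma diag_conj_polar {C : numClosedFieldType} {n} (P : 'M[C]_n)
    (d : 'I_n -> C) : P \is unitarymx -> (forall i, d i \is Num.real) ->
  exists J W, polar (diag_conj P d) J W /\
    W *m W = diag_conj P (fun i => `|d i|).
Proof.
move=> Pu dr; pose s i : C := (-1) ^+ (d i < 0)%R; pose r i := sqrtC `|d i|.
have rr i : r i * r i = `|d i| by rewrite -expr2 sqrtCK.
have eqd (e e' : 'I_n -> C) : e =1 e' -> diag_conj P e = diag_conj P e'.
  by move=> ee'; congr (_ *m diag_mx _ *m _); apply/rowP => i; rewrite !mxE.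
exists (diag_conj P s), (diag_conj P r); split; last first.
  by rewrite diag_conjM //; apply: eqd.
split; rewrite ?diag_conjM //.
- split.
    by apply: diag_conj_herm => i; rewrite rpredX ?rpredN ?rpred1.
  rewrite diag_conjM // (eqd _ (fun=> 1)) => [|i]; last first.
    by rewrite -expr2 sqrr_sign.
  rewrite /diag_conj (_ : diag_mx _ = 1%:M) ?mulmx1 -?invmx_unitary //.
    by rewrite mulVmx // unitarymx_unit.
  by rewrite -diag_const_mx; congr diag_mx; apply/rowP => i; rewrite !mxE.
- by apply: diag_conj_herm => i; rewrite ger0_real // sqrtC_ge0.
- by apply: eqd => i; rewrite mulrC.
by apply: eqd => i; rewrite -mulrA rr /s -realEsign.
Qed.

(** * Real symmetric matrices *)

(** The spectral theorem for a real symmetric matrix, with a complex unitary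
    change of basis. *)
Lemma realsym_spectral {R : realType} {n} (A : 'M[R]_n) : A^T = A ->
  exists (P : 'M[R[i]]_n) (d : 'I_n -> R), [/\ P \is unitarymx,
    map_mx (real_complex R) A = diag_conj P (fun i => real_complex R (d i)) &
    perm_eq (eigenvalues A) [seq d i | i <- enum 'I_n]].
Proof.
move=> Asym; pose f := real_complex R; pose B := map_mx f A.
have Bherm : B \is hermsymmx.
  apply: realsym_hermsym.
    apply/is_hermitianmxP; rewrite expr0 scale1r.
    by apply/matrixP => i j; rewrite !mxE -[in LHS]Asym mxE.
  by apply/mxOverP => i j; rewrite mxE /f complex_real.
have /hermitian_spectral_diag_real /mxOverP dreal := Bherm.
have /orthomx_spectralP Bdiag := hermitian_normalmx Bherm.
pose d i := complex.Re (spectral_diag B 0 i); pose P := spectralmx B.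
have Pu : P \is unitarymx by exact: spectral_unitarymx.
have fd i : f (d i) = spectral_diag B 0 i by exact: RRe_real.
have BE : B = diag_conj P (fun i => f (d i)).
  rewrite {1}Bdiag /diag_conj invmx_unitary //.
  by congr (_ *m diag_mx _ *m _); apply/rowP => i; rewrite !mxE fd.
exists P, d; split=> //; apply: eigenvalues_perm; apply: (map_poly_inj f).
rewrite map_char_poly -/B BE diag_conj_char_poly //.
rewrite rmorph_prod big_map big_enum /=.
by apply: eq_bigr => i _; rewrite rmorphB /= map_polyX map_polyC.
Qed.

Lemma normr_real_complex (R : realType) (a : R) :
  `|real_complex R a| = real_complex R `|a|.
Proof. by rewrite normc_def expr0n addr0 sqrtr_sqr. Qed.

(** The trace norm of A - c I is the sum of the |a - c| over the eigenvalues a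
    of A. *)
Lemma realsym_polar {R : realType} {n} (A : 'M[R]_n) (c : R) : A^T = A ->
  exists J W, polar (map_mx (real_complex R) (A - c%:M)) J W /\
    \tr (W *m W) = real_complex R (\sum_(a <- eigenvalues A) `|a - c|).
Proof.
move=> Asym; pose f := real_complex R.
have [P [d [Pu AE /(perm_big _) ->]]] := realsym_spectral A Asym.
have shift : map_mx f (A - c%:M) = diag_conj P (fun i => f (d i - c)).
  rewrite map_mxB AE map_scalar_mx; apply/eqP; rewrite subr_eq; apply/eqP.
  (* Scalar matrices are invariant under conjugation by P. *)
  have -> : (f c)%:M = P^t* *m (f c)%:M *m P.
    by rewrite scalar_mxC -mulmxA -invmx_unitary // mulVmx ?mulmx1
      ?unitarymx_unit.
  rewrite /diag_conj -mulmxDl -mulmxDr -diag_const_mx -linearD.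
  congr (_ *m diag_mx _ *m _).
  by apply/rowP => i; rewrite !mxE -rmorphD subrK.
have [|J [W [pJW WW]]] := diag_conj_polar P (fun i => f (d i - c)) Pu.
  by move=> i; rewrite /f complex_real.
exists J, W; rewrite shift; split=> //; rewrite WW diag_conj_tr // big_map.
rewrite big_enum rmorph_sum; apply: eq_bigr => i _.
exact: normr_real_complex.
Qed.

Lemma polarN {C : numClosedFieldType} {n} (T J W : 'M[C]_n) :
  polar T J W -> polar (- T) (- J) W.
Proof.
move=> [[Jh JJ] Wh JW ->]; split; rewrite ?mulNmx ?mulmxN ?JW //; split.
  by rewrite linearN map_mxN Jh.
by rewrite mulNmx mulmxN opprK.
Qed.

(** * Perturbation by a diagonal matrix *)

(** The triangle inequality for the trace norms of a real diagonal matrix and a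
    Hermitian matrix B with zero diagonal, with its equality case. *)
Lemma polar_diagD {C : numClosedFieldType} {n} (x : 'I_n -> C)
    (B J W J' W' : 'M[C]_n) :
    (forall i, x i \is Num.real) -> (forall i, B i i = 0) ->
    polar B J W -> polar (diag_mx (\row_i x i) + B) J' W' ->
  \tr (W' *m W') <= \sum_i `|x i| + \tr (W *m W) /\
  (\tr (W' *m W') = \sum_i `|x i| + \tr (W *m W) ->
   forall i, x i != 0 -> row i B = 0).
Proof.
move=> xr B0 pB [[J'h J'J'] W'h J'W' ME]; set X := diag_mx _ in ME.
have u1 : (1%:M : 'M[C]_n) \is unitarymx.
  by apply/unitarymxP; rewrite trmx1 map_mx1 mulmx1.
have [K [V [pX VV]]] := diag_conj_polar _ x u1 xr.
rewrite diag_conj1 -/X in pX.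
have trV : \sum_i `|x i| = \tr (V *m V) by rewrite VV diag_conj_tr.
have hJ' : hermitian_involution J' by [].
have trE : \tr (W' *m W') = \tr (J' *m X) + \tr (J' *m B).
  by rewrite -raddfD -mulmxDr ME /= -!mulmxA mulmxA J'J' mul1mx.
have leX := polar_trace_le _ _ _ _ pX hJ'.
have leB := polar_trace_le _ _ _ _ pB hJ'.
rewrite trE trV; split=> [|E i xi0]; first exact: lerD.
have EX : \tr (J' *m X) = \tr (V *m V).
  by apply/eqP; rewrite eq_le leX -(lerD2r (\tr (W *m W))) -E lerD2l.
have EB : \tr (J' *m B) = \tr (W *m W).
  by apply: (addrI (\tr (V *m V))); rewrite -E EX.
have [XJ _] := polar_trace_eq _ _ _ _ pX hJ' EX.
have [_ JB] := polar_trace_eq _ _ _ _ pB hJ' EB.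
(* Since X *m J' = |X|, row i of J' is a multiple of the i-th basis vector. *)
have J'i j : i != j -> J' i j = 0.
  move=> ij; have := congr1 (fun M : 'M_n => M i j) XJ.
  rewrite VV diag_conj1 mul_diag_mx !mxE (negPf ij) mulr0n => /eqP.
  by rewrite mulf_eq0 (negPf xi0) => /eqP.
have [[Jh JJ] Wh JW BE] := pB.
(* This entry is the squared norm of row i of W. *)
have WWii : (W *m W) i i = 0.
  rewrite -JB mxE (bigD1 i) //= B0 mulr0 add0r big1 // => j ji.
  by rewrite J'i ?mul0r // eq_sym.
have Wi : row i W = 0 by apply: mulmx_trC_diag_eq0; rewrite Wh.
by rewrite BE JW -mulmxA row_mul Wi mul0mx.
Qed.

(** * Graphs *)

Lemma graph_connected_neighbor (G : sgraph) (u v : G) :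
  graph_connected G -> u != v -> exists b : G, edge u b.
Proof.
move=> Gc uv; have /connectP[[|b p] /= hp] := Gc u v.
  by move=> vu; rewrite vu eqxx in uv.
by move=> _; exists b; case/andP: hp.
Qed.

Lemma weight_regularP (R : realType) (G : sgraph) (w : G -> R) :
  weight_regular w <-> forall v, w v = mean_weight w.
Proof.
split=> [wr v|wm u v]; last by rewrite !wm.
rewrite /mean_weight (eq_bigr (fun=> w v)) => [|u _]; last exact: wr.
rewrite sumr_const -(mulr_natl (w v)) mulKf //.
by rewrite pnatr_eq0 -lt0n vertex_gt0.
Qed.

Lemma adjmx_row_neq0 (R : realType) (G : sgraph) (u b : G) :
  edge u b -> row (enum_rank u) (adjmx R G) != 0.
Proof.
move=> ub; apply/eqP => /rowP /(_ (enum_rank b)) /eqP.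
by rewrite !mxE !enum_rankK ub oner_eq0.
Qed.

Theorem theorem3 (R : realType) (G : sgraph) (w : G -> R)
    (w_gt0 : forall v : G, 0 < w v) (G_conn : graph_connected G) :
  weighted_laplacian_energy w <= #|G|%:R * mean_deviation w + energy R G
  /\ (weighted_laplacian_energy w = #|G|%:R * mean_deviation w + energy R G
      <-> weight_regular w).
Proof.
pose f := real_complex R; pose m := mean_weight w.
have f_inj : injective f := fmorph_inj _.
have fD a b : f (a + b) = f a + f b by exact: rmorphD.
have f_le a b : (f a <= f b) = (a <= b) by exact: lecR.
have [J [W [/polarN pB trW]]] := realsym_polar _ 0 (adjmx_sym R G).
have [J' [W' [pL trW']]] := realsym_polar _ m (weighted_laplacian_sym w).
pose x (i : 'I_#|G|) := f (w (enum_val i) - m).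
set B := - _ in pB.
have LE : map_mx f (weighted_laplacian w - m%:M) = diag_mx (\row_i x i) + B.
  apply/matrixP => i j; rewrite !mxE /x -rmorphN -rmorphMn -rmorphD.
  by congr f; rewrite mul0rn subr0 mulrnBl addrAC.
rewrite LE in pL.
have B0 i : B i i = 0.
  by rewrite !mxE edge_irrefl mul0rn subr0 rmorph0 oppr0.
have xr i : x i \is Num.real by rewrite /x /f complex_real.
have [le eq] := polar_diagD x _ _ _ _ _ xr B0 pB pL.
have devE : f (#|G|%:R * mean_deviation w) = \sum_i `|x i|.
  rewrite /mean_deviation mulVKf; last first.
    by rewrite pnatr_eq0 -lt0n vertex_gt0.
  rewrite /f rmorph_sum (reindex _ (onW_bij _ (enum_val_bij G))) /=.
  by apply: eq_bigr => i _; rewrite normr_real_complex.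
have trE : f (energy R G) = \tr (W *m W).
  by rewrite trW /energy; congr f; apply: eq_bigr => a _; rewrite subr0.
have {}trW' : f (weighted_laplacian_energy w) = \tr (W' *m W') by [].
rewrite -trE -devE -trW' -fD in le eq.
split; first by rewrite -f_le.
split=> [E | /weight_regularP wr].
  have rowB := eq (congr1 f E).
  have [/forallP wm|/forallPn[u wu]] := boolP [forall v, w v == m].
    by apply/weight_regularP => v; apply/eqP.
  (* A vertex u of non-mean weight is isolated, so it is the only vertex. *)
  have uall v : u = v.
    apply/eqP/negPn/negP => /(graph_connected_neighbor _ _ _ G_conn)[b ub].
    have /negP := adjmx_row_neq0 R _ _ _ ub; apply.
    have xu : x (enum_rank u) != 0.
      by rewrite /x enum_rankK fmorph_eq0 subr_eq0.
    apply/eqP/rowP => j; have /rowP /(_ j) := rowB _ xu.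
    rewrite !mxE mul0rn subr0 => /eqP.
    by rewrite oppr_eq0 fmorph_eq0 => /eqP.
  by move=> v1 v2; rewrite -(uall v1) -(uall v2).
have x0 i : x i = 0 by rewrite /x /f wr subrr rmorph0.
apply: f_inj; rewrite fD devE big1 ?add0r => [|i _]; last first.
  by rewrite x0 normr0.
rewrite trE trW'; apply: (polar_trace_uniq _ _ _ _ _ pL).
have -> : diag_mx (\row_i x i) = 0; last by rewrite add0r; exact: pB.
by apply/matrixP => i j; rewrite !mxE x0 mul0rn.
Qed.
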